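(* Let $f\in\omega^\omega$ be increasing, $b:\omega\to(\omega+1)\smallsetminus\{0\}$ and $h\in\omega^\omega$. If $2^f\ll b$ and there is $l^*<\omega$ with $h\leq^*\mathrm{id}_\omega^{l^*}$, then $\min\{\mathfrak{b},\mathfrak{b}^{\mathrm{Lc}}_{b,h}\}\leq\mathrm{add}(\mathcal{I}_f)$ and $\mathrm{cof}(\mathcal{I}_f)\leq\max\{\mathfrak{d},\mathfrak{d}^{\mathrm{Lc}}_{b,h}\}$.
   Context: $\mathfrak{b},\mathfrak{d}$: bounding and dominating numbers. $2^f$ is the function $n\mapsto2^{f(n)}$ and $\mathrm{id}_\omega^{l^*}$ is $n\mapsto n^{l^*}$. For $f,g$ from $\omega$ to the ordinals, $f\ll g$ iff $\forall k<\omega\,\forall^\infty n\,(f(n^k)\leq g(n))$. Yorioka ideals: for $\sigma\in(2^{<\omega})^\omega$, $[\sigma]_\infty=\{x\in2^\omega:\exists^\infty n\,(\sigma(n)\subseteq x)\}$, $h_\sigma(i)=|\sigma(i)|$; $\mathcal{J}_g=\{X\subseteq2^\omega:\exists\sigma\,(X\subseteq[\sigma]_\infty,\ h_\sigma=g)\}$; $\mathcal{I}_f=\bigcup_{g\gg f,\,g\in\omega^\omega}\mathcal{J}_g$. $\mathcal{S}(b,h)=\prod_n[b(n)]^{\leq h(n)}$; $\mathfrak{b}^{\mathrm{Lc}}_{b,h}$: least size of $F\subseteq\prod b$ such that no $\varphi\in\mathcal{S}(b,h)$ satisfies, for all $x\in F$, $x(n)\in\varphi(n)$ for almost all $n$;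 $\mathfrak{d}^{\mathrm{Lc}}_{b,h}$: least size of $D\subseteq\mathcal{S}(b,h)$ such that every $x\in\prod b$ satisfies $x(n)\in\varphi(n)$ for almost all $n$, for some $\varphi\in D$. *)

(* Defs.v *)
From mathcomp Require Import all_boot.
From mathcomp Require Import boolp classical_sets functions cardinality filter.

Set Implicit Arguments.
Unset Strict Implicit.
Unset Printing Implicit Defensive.

Local Open Scope classical_set_scope.
Local Open Scope card_scope.

(* Cardinals, given by a representing set and compared by injections, with a
   top element as the least size of an empty class of sets.  Equipotent sets
   represent the same cardinal, so only [cle] is meaningful, not Leibniz
   equality. *)
Inductive cardinal : Type :=
| Card (T : Type) (A : set T)
| Infty.

Definition cle (x y : cardinal) : bool :=
  match x, y with
  | _, Infty => true
  | Infty, Card _ _ => false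
  | Card _ A, Card _ B => A #<= B
  end.

Declare Scope cardinal_scope.
Delimit Scope cardinal_scope with cardinal.
Notation "x <= y" := (cle x y) : cardinal_scope.
Bind Scope cardinal_scope with cardinal.

Definition cmin (x y : cardinal) : cardinal := if cle x y then x else y.
Definition cmax (x y : cardinal) : cardinal := if cle x y then y else x.

(* Apply Zorn's lemma to the sets of choice functions j |-> p j \in j on which
   every projection is injective: some projection of a maximal one is onto. *)
Lemma ex_smallest (T : Type) (P : set (set T)) : P !=set0 ->
  exists A, P A /\ forall B, P B -> A #<= B.
Proof.
move=> [A PA]; pose J := {A : set T | P A}.
pose G (S : set (J -> T)) := (forall p, S p -> forall j, sval j (p j)) /\
  (forall j p q, S p -> S q -> p j = q j -> p = q).
have [F FG Ftot|S [[Sin Sinj] Smax]] := @Zorn_bigcup (J -> T) G.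
  split=> [p [X /FG[+ _] Xp]|j p q [X FX Xp] [Y FY Yq]]; first exact.
  have [XY|YX] := Ftot X Y FX FY.
    by apply: (FG Y FY).2 => //; exact: XY.
  by apply: (FG X FX).2 => //; exact: YX.
have [j jS] : exists j : J, sval j `<=` (fun p => p j) @` S.
  apply: contrapT => /forallNP noj.
  have /choice[c cP] (j : J) : exists a, sval j a /\ ~ ((fun p => p j) @` S) a.
    apply: contrapT => /forallNP h; apply: (noj j) => a ja.
    by apply: contrapT => na; exact: (h a).
  apply: (Smax (S `|` [set c])).
    split=> [p Sp|cS]; first by left.
    by case: (cP (exist _ A PA)) => _; apply; exists c => //; apply: cS; right.
  split=> [p [/Sin//|-> j]|j p q [Sp|->] [Sq|->]] //.
  - exact: (cP j).1.
  - exact: Sinj.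
  - by move=> pc; case: (cP j) => _ []; exists p.
  - by move=> qc; case: (cP j) => _ []; exists q.
exists (sval j); split=> [|B PB]; first exact: (svalP j).
apply: card_le_trans (subset_card_le jS) _.
apply: card_le_trans (card_image_le _ _) _.
pose k : J := exist _ B PB.
have inj_k : {in S &, injective (fun p : J -> T => p k)}.
  by move=> p q /set_mem Sp /set_mem Sq; exact: Sinj.
have /card_eqPle[_ le] := inj_card_eq inj_k.
apply: card_le_trans le _; apply: subset_card_le => _ [p Sp <-].
exact: (Sin p Sp k).
Qed.

Definition least_size (T : Type) (P : set (set T)) : cardinal :=
  if pselect (P !=set0) is left P0 then Card (sval (cid (ex_smallest P0)))
  else Infty.

(* The ordinals up to omega. *)
Inductive ord_omega : Type := Fin of nat | Omega.

Definition ole (x y : ord_omega) : bool :=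
  match x, y with
  | _, Omega => true
  | Omega, Fin _ => false
  | Fin m, Fin n => m <= n
  end.

(* An ordinal as the set of its predecessors. *)
Definition elems (x : ord_omega) : set nat :=
  if x is Fin m then `I_m else setT.

(* f << g, for f and g with values at most omega. *)
Definition ll (f g : nat -> ord_omega) : Prop :=
  forall k : nat, \forall n \near \oo, ole (f (n ^ k)) (g n).

Definition pow2 (f : nat -> nat) : nat -> nat := fun n => 2 ^ f n.

Definition le_star (f g : nat -> nat) : Prop :=
  \forall n \near \oo, f n <= g n.

Definition frak_b : cardinal :=
  least_size [set F : set (nat -> nat) |
    ~ exists y, forall x, F x -> le_star x y].

Definition frak_d : cardinal :=
  least_size [set D : set (nat -> nat) |
    forall x, exists2 y, D y & le_star x y].

Definition initial_segment (s : seq bool) (x : nat -> bool) : Prop :=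
  forall i, i < size s -> nth false s i = x i.

Definition limsup_cyl (sigma : nat -> seq bool) : set (nat -> bool) :=
  [set x | forall m, exists2 n, m <= n & initial_segment (sigma n) x].

Definition J_ideal (g : nat -> nat) : set (set (nat -> bool)) :=
  [set X | exists sigma : nat -> seq bool,
    X `<=` limsup_cyl sigma /\ forall i, size (sigma i) = g i].

Definition yorioka (f : nat -> nat) : set (set (nat -> bool)) :=
  [set X | exists2 g : nat -> nat, ll (Fin \o f) (Fin \o g) & J_ideal g X].

Definition add (T : Type) (I : set (set T)) : cardinal :=
  least_size [set F : set (set T) | F `<=` I /\ ~ I (\bigcup_(X in F) X)].

Definition cof (T : Type) (I : set (set T)) : cardinal :=
  least_size [set C : set (set T) |
    C `<=` I /\ forall X, I X -> exists2 Y, C Y & X `<=` Y].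

Definition prod_of (b : nat -> ord_omega) : set (nat -> nat) :=
  [set x | forall n, elems (b n) (x n)].

Definition slaloms (b : nat -> ord_omega) (h : nat -> nat) :
    set (nat -> set nat) :=
  [set phi | forall n, phi n `<=` elems (b n) /\ phi n #<= `I_(h n)].

Definition localized (x : nat -> nat) (phi : nat -> set nat) : Prop :=
  \forall n \near \oo, phi n (x n).

Definition b_Lc (b : nat -> ord_omega) (h : nat -> nat) : cardinal :=
  least_size [set F : set (nat -> nat) | F `<=` prod_of b /\
    ~ exists2 phi, slaloms b h phi & forall x, F x -> localized x phi].

Definition d_Lc (b : nat -> ord_omega) (h : nat -> nat) : cardinal :=
  least_size [set D : set (nat -> set nat) | D `<=` slaloms b h /\
    forall x, prod_of b x -> exists2 phi, D phi & localized x phi].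

(* Main.v *)
Require Import Defs.
From mathcomp Require Import all_boot.
From mathcomp Require Import boolp classical_sets functions cardinality filter.

(* Given members X of I_f, covered by sigma_X with |sigma_X(n)| >= f(n^k) for all
   n >= K_X(k), let N dominate all the threshold functions K_X and also the
   thresholds witnessing 2^f << b.  If k(n) is the largest k <= n with N(k) <= n,
   then g(n) = f(n^k(n)) still satisfies g >> f, is eventually below every
   |sigma_X|, and 2^g(n) <= b(n) eventually.  So sigma_X can be truncated to length
   g and coded by a member of prod b.  A slalom localizing these codes offers at
   most n^l strings of length g(n) at n; listing them in the block
   [n^(l+1), (n+1)^(l+1)) reindexes n polynomially only, so the resulting single
   sequence has length function >> f, and its limsup contains every X.
   For cof one also needs kappa * kappa = kappa for infinite cardinals. *)

Set Implicit Arguments.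
Unset Strict Implicit.
Unset Printing Implicit Defensive.

Local Open Scope classical_set_scope.
Local Open Scope card_scope.

(** * Cardinal inequalities by way of explicit injections and surjections *)

Lemma card_le_injE (T U : Type) (A : set T) (B : set U) (u0 : U) :
  A #<= B -> exists2 f : T -> U, (forall x, A x -> B (f x)) &
    (forall x y, A x -> A y -> f x = f y -> x = y).
Proof.
elim/Ppointed: U => U in B u0 *.
  by have : [set: U] u0 by []; rewrite (empty_eq0 [set: U]).
move=> /pcard_leP[f]; exists f => [x Ax|x y Ax Ay]; first exact: funS.
by apply: 'inj_f; rewrite inE.
Qed.

Lemma card_le_injI (T U : Type) (A : set T) (B : set U) (f : T -> U) :
  (forall x, A x -> B (f x)) ->
  (forall x y, A x -> A y -> f x = f y -> x = y) -> A #<= B.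
Proof.
move=> fAB finj; have fi : {in A &, injective f}.
  by move=> x y /set_mem Ax /set_mem Ay; exact: finj.
have /card_eqPle[_ le] := inj_card_eq fi.
by apply: card_le_trans le _; apply: subset_card_le => _ [x Ax <-]; exact: fAB.
Qed.

Lemma card_le_surjE (T U : Type) (A : set T) (B : set U) (t0 : T) :
  A #<= B -> exists f : U -> T, A `<=` f @` B.
Proof.
elim/Ppointed: T => T in A t0 *.
  by have : [set: T] t0 by []; rewrite (empty_eq0 [set: T]).
by move=> /pcard_geP[f]; exists f => x Ax; exact: 'surj_f.
Qed.

Lemma card_le_surjI (T U : Type) (A : set T) (B : set U) (f : U -> T) :
  A `<=` f @` B -> A #<= B.
Proof. by move=> /subset_card_le/card_le_trans; apply; exact: card_image_le. Qed.

Lemma card_leX (T T' U U' : Type) (A : set T) (A' : set T') (B : set U)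
    (B' : set U') : A #<= A' -> B #<= B' -> A `*` B #<= A' `*` B'.
Proof.
move=> AA' BB'.
have [->|/set0P[[a b] [/= Aa Bb]]] := eqVneq (A `*` B) set0; first exact: card_ge0.
have [f fP] := card_le_surjE a AA'; have [g gP] := card_le_surjE b BB'.
apply: (@card_le_surjI _ _ _ _ (fun p => (f p.1, g p.2))) => -[x y] [/= Ax By].
have [x' A'x' <-] := fP _ Ax; have [y' B'y' <-] := gP _ By.
by exists (x', y').
Qed.

(** Both sets are copied into the sum type, where [ex_smallest] picks the smaller copy. *)
Lemma card_le_total (T U : Type) (A : set T) (B : set U) :
  A #<= B \/ B #<= A.
Proof.
have inlI : @inl T U @` A #= A by apply: inj_card_eq => x y _ _ [].
have inrI : @inr T U @` B #= B by apply: inj_card_eq => x y _ _ [].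
have [|_ [[->|->] le]] := @ex_smallest (T + U)%type [set inl @` A; inr @` B].
- by exists (inl @` A); left.
- left; have := le (inr @` B) (or_intror erefl).
  by rewrite (card_le_eql inlI) (card_le_eqr inrI).
- right; have := le (inl @` A) (or_introl erefl).
  by rewrite (card_le_eql inrI) (card_le_eqr inlI).
Qed.

(** * Hessenberg's theorem: squares of infinite sets *)

Section hessenberg.
Variables (T : Type) (A : set T).

Definition square_inj (B : set T) (f : T -> T -> T) : Prop :=
  [/\ B `<=` A, infinite_set B, forall x y, B x -> B y -> B (f x y) &
    forall x y x' y', B x -> B y -> B x' -> B y' ->
      f x y = f x' y' -> x = x' /\ y = y'].

Lemma square_inj_countable : infinite_set A -> exists B f, square_inj B f.
Proof.
move=> infA; have [a0 Aa0] := infinite_setN0 infA.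
have [e eA einj] := card_le_injE a0 ((infiniteP A).1 infA).
have infB : infinite_set (range e).
  by apply/infiniteP/(@card_le_injI _ _ _ _ e) => [x _|x y]; [exists x|exact: einj].
have : range e `*` range e #<= range e.
  have cB : countable (range e) by exact: card_image_le.
  by apply: (card_le_trans (countableX cB cB)); exact/infiniteP.
move=> /(card_le_injE a0)[g gB ginj].
exists (range e), (fun x y => g (x, y)); split => //.
- by move=> _ [n _ <-]; exact: eA.
- by move=> x y Bx By; exact: gB.
- move=> x y x' y' Bx By Bx' By'.
  by move=> /(ginj (x, y) (x', y') (conj Bx By) (conj Bx' By'))[].
Qed.

(** Extension of partial squarings. It is only a preorder, since the values off the domain are
    ignored. *)
Definition sq_le (v w : {p : set T * (T -> T -> T) | square_inj p.1 p.2}) : Prop :=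
  (sval v).1 `<=` (sval w).1 /\
  forall x y, (sval v).1 x -> (sval v).1 y -> (sval v).2 x y = (sval w).2 x y.

(** The bound lives on the union of the domains: finitely many points of the union lie in the domain
    of one member of the chain, so each condition is checked there. *)
Lemma square_inj_chain (F : set {p : set T * (T -> T -> T) | square_inj p.1 p.2}) :
  F !=set0 -> total_on F sq_le -> exists w, forall v, F v -> sq_le v w.
Proof.
move=> [v0 Fv0] Ftot.
pose B := \bigcup_(v in F) (sval v).1.
have common v w : F v -> F w -> exists u, [/\ F u, sq_le v u & sq_le w u].
  have refl t : sq_le t t by split.
  by move=> Fv Fw; have [vw|wv] := Ftot v w Fv Fw; [exists w|exists v].
pose good x y z := exists v, [/\ F v, (sval v).1 x, (sval v).1 y &
  z = (sval v).2 x y].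
have goodP x y : exists z, B x -> B y -> good x y z.
  have [[[v Fv vx] [w Fw wy]]|nB] := pselect (B x /\ B y); last first.
    by exists x => Bx By; case: nB.
  have [u [Fu vu wu]] := common v w Fv Fw.
  by exists ((sval u).2 x y) => _ _; exists u; split=> //; [apply: vu.1|apply: wu.1].
pose f x y := sval (cid (goodP x y)).
have fE v x y : F v -> (sval v).1 x -> (sval v).1 y -> f x y = (sval v).2 x y.
  move=> Fv vx vy; rewrite /f; case: cid => z /= zP.
  have [w [Fw wx wy ->]] := zP (ex_intro2 _ _ v Fv vx) (ex_intro2 _ _ v Fv vy).
  have [u [Fu [_ vu] [_ wu]]] := common v w Fv Fw.
  by rewrite vu // wu.
have BfP : square_inj B f.
  split.
  - by move=> x [v Fv vx]; case: (svalP v) => + _ _ _; apply.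
  - have [_ + _ _] := svalP v0; apply: sub_infinite_set => x v0x.
    by exists v0.
  - move=> x y [v Fv vx] [w Fw wy].
    have [u [Fu [vu _] [wu _]]] := common v w Fv Fw.
    rewrite (fE u) //; [|exact: vu|exact: wu].
    exists u => //; have [_ _ + _] := svalP u.
    by apply; [exact: vu|exact: wu].
  - move=> x y x' y' [v1 F1 v1x] [v2 F2 v2y] [v3 F3 v3x] [v4 F4 v4y].
    have [u [Fu [v1u _] [v2u _]]] := common v1 v2 F1 F2.
    have [u' [Fu' [v3u _] [v4u _]]] := common v3 v4 F3 F4.
    have [w [Fw [uw _] [u'w _]]] := common u u' Fu Fu'.
    have [wx wy] : (sval w).1 x /\ (sval w).1 y.
      by split; apply: uw; [apply: v1u|apply: v2u].
    have [wx' wy'] : (sval w).1 x' /\ (sval w).1 y'.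
      by split; apply: u'w; [apply: v3u|apply: v4u].
    rewrite !(fE w) //; have [_ _ _ +] := svalP w; exact.
exists (exist _ (B, f) BfP) => v Fv; split=> /=.
- by move=> x vx; exists v.
- by move=> x y vx vy; rewrite (fE v).
Qed.

(* Take a copy C of B in A `\` B; the pairs from B `|` C outside B `*` B are sent
   into C, by a B-coded tag for the type of the pair followed by f. *)
Lemma square_inj_extend (B : set T) (f : T -> T -> T) :
  square_inj B f -> B #<= A `\` B ->
  exists B' g, [/\ square_inj B' g, B `<=` B', ~ B' `<=` B &
    forall x y, B x -> B y -> f x y = g x y].
Proof.
move=> [BA infB fB finj] leB.
have [t0 Bt0] := infinite_setN0 infB.
have [c cB cinj] := card_le_injE t0 leB.
have [e eB einj] := card_le_injE t0 ((infiniteP B).1 infB).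
pose C := c @` B.
have CB x : C x -> ~ B x by move=> [y By <-]; case: (cB y By).
(* The retraction [r] is the identity on [B] and inverts [c] on [C]. *)
have rP x : exists y, (B x -> y = x) /\ (C x -> B y /\ c y = x).
  have [Bx|nBx] := pselect (B x); first by exists x; split=> // /CB.
  have [[y By yx]|nCx] := pselect (C x); first by exists y; split=> //.
  by exists x; split => //.
pose r x := sval (cid (rP x)).
have rB x : B x -> r x = x by rewrite /r; case: cid => y /= [].
have rC x : C x -> B (r x) /\ c (r x) = x by rewrite /r; case: cid => y /= [].
have rBC x : (B `|` C) x -> B (r x) by move=> [Bx|/rC[]//]; rewrite rB.
have rinj x y : (B `|` C) x -> (B `|` C) y -> `[< B x >] = `[< B y >] ->
    r x = r y -> x = y.
  move=> [Bx|Cx] [By|Cy].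
  - by rewrite !rB.
  - by move: (CB _ Cy) => nBy; rewrite (asboolT Bx) (asboolF nBy).
  - by move: (CB _ Cx) => nBx; rewrite (asboolT By) (asboolF nBx).
  - by have [_ xE] := rC _ Cx; have [_ yE] := rC _ Cy => _ rxy; rewrite -xE rxy.
(* The tag encodes in binary which of [x], [y] lie in [B]. *)
pose t x y := e (`[< B x >].*2 + `[< B y >]).
have tinj x y x' y' : t x y = t x' y' ->
    `[< B x >] = `[< B x' >] /\ `[< B y >] = `[< B y' >].
  move=> /(einj _ _ I I).
  by case: asboolP => _; case: asboolP => _; case: asboolP => _; case: asboolP.
pose g x y := if pselect (B x /\ B y) is left _ then f x y
              else c (f (t x y) (f (r x) (r y))).
exists (B `|` C), g; split; [split| | |].
- by move=> x [/BA//|[y By <-]]; case: (cB y By).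
- by apply: sub_infinite_set infB => x; left.
- move=> x y Bx By; rewrite /g; case: pselect => [[Bx' By']|_].
    by left; exact: fB.
  right; exists (f (t x y) (f (r x) (r y))) => //.
  by apply: (fB _ _ (eB _ I)); apply: fB; exact: rBC.
- move=> x y x' y' Bx By Bx' By'.
  have kB u v : (B `|` C) u -> (B `|` C) v -> B (f (r u) (r v)).
    by move=> Bu Bv; apply: fB; exact: rBC.
  have lB u v : (B `|` C) u -> (B `|` C) v -> B (f (t u v) (f (r u) (r v))).
    by move=> Bu Bv; apply: fB; [exact: eB|exact: kB].
  rewrite /g; case: pselect => [[Bx1 By1]|n1]; case: pselect => [[Bx2 By2]|n2].
  + exact: finj.
  (* Mixed cases cannot occur: [f] takes its values in [B], and [c] outside. *)
  + by move=> ff; case: (cB _ (lB _ _ Bx' By')) => _; rewrite -ff; case; exact: fB.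
  + by move=> ff; case: (cB _ (lB _ _ Bx By)) => _; rewrite ff; case; exact: fB.
  + move=> /cinj; move=> /(_ (lB _ _ Bx By) (lB _ _ Bx' By')).
    move=> /finj[]; [exact: eB|exact: kB|exact: eB|exact: kB|].
    move=> /tinj[ex ey] /finj[]; [exact: rBC..|] => rx ry.
    by split; apply: rinj.
- by move=> x; left.
- move=> /(_ (c t0)) h; have [_] := cB _ Bt0; apply; apply: h.
  by right; exists t0.
- by move=> x y Bx By; rewrite /g; case: pselect => // -[].
Qed.

(** Let [B] carry a maximal squaring. Unless the rest of [A] embeds into [B], it contains a copy of
    [B] and the squaring extends. So [A] embeds into [B], and the squaring of [B] serves for [A]. *)
Lemma infinite_setX_le : infinite_set A -> A `*` A #<= A.
Proof.
move=> infA; have [B0 [f0 P0]] := square_inj_countable infA.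
have [||F Ftot|[[B f] /= Bf] wmax] := @ZL_preorder
    {p : set T * (T -> T -> T) | square_inj p.1 p.2}
    (exist _ (B0, f0) P0) (fun v w => `[< sq_le v w >]).
- by move=> v; apply/asboolP; split.
- move=> v u w /asboolP[uv uvE] /asboolP[vw vwE]; apply/asboolP; split.
    exact: subset_trans uv vw.
  by move=> x y ux uy; rewrite uvE // vwE //; exact: uv.
- have Ftot' : total_on F sq_le.
    by move=> v w Fv Fw; have [/asboolP|/asboolP] := Ftot v w Fv Fw; [left|right].
  have [->|/set0P F0] := eqVneq F set0; first by exists (exist _ (B0, f0) P0).
  have [w wP] := square_inj_chain F0 Ftot'.
  by exists w => v /wP/asboolP.
have [BA infB fB finj] := Bf.
have AB : A `\` B #<= B.
  have [//|] := card_le_total (A `\` B) B.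
  move=> /(square_inj_extend Bf)[B' [g [gP BB' nB'B fg]]].
  case: nB'B; suff /asboolP[] :
    `[< sq_le (exist _ (B', g) gP) (exist _ (B, f) Bf) >] by [].
  by apply: wmax; apply/asboolP; split.
have [t0 Bt0] := infinite_setN0 infB.
have [e eB einj] := card_le_injE t0 ((infiniteP B).1 infB).
have [d dB dinj] := card_le_injE t0 AB.
(* The tags [e 0] and [e 1] keep the images of [B] and of its complement apart. *)
have leAB : A #<= B.
  apply: (@card_le_injI _ _ _ _
    (fun x => if pselect (B x) is left _ then f (e 0) x else f (e 1) (d x))).
    move=> x Ax; case: pselect => Bx; apply: fB => //; try exact: eB.
    exact: dB.
  move=> x y Ax Ay; case: pselect => Bx; case: pselect => By /finj[]//;
    try exact: eB; try exact: dB.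
  - by move=> /einj => /(_ I I).
  - by move=> /einj => /(_ I I).
  - by move=> _; exact: dinj.
apply: card_le_trans (card_leX leAB leAB) _.
apply: card_le_trans (subset_card_le BA).
apply: (@card_le_injI _ _ _ _ (fun p => f p.1 p.2)) => [[x y] []|]; first exact: fB.
by move=> [x y] [x' y'] [/= Bx By] [/= Bx' By'] /finj[]// -> ->.
Qed.

End hessenberg.

(** * Least sizes and the order of cardinals *)

Lemma least_size_le (T : Type) (P : set (set T)) (A : set T) :
  P A -> (least_size P <= Card A)%cardinal.
Proof.
move=> PA; rewrite /least_size; case: pselect => [P0|]; last by case; exists A.
by case: cid => B [PB Bmin] /=; exact: Bmin.
Qed.

Variant least_size_spec (T : Type) (P : set (set T)) : cardinal -> Prop :=
| LeastSizeInfty : least_size_spec P Infty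
| LeastSizeCard (A : set T) of P A : least_size_spec P (Card A).

Lemma least_sizeP (T : Type) (P : set (set T)) : least_size_spec P (least_size P).
Proof.
rewrite /least_size; case: pselect => [P0|]; last by left.
by case: cid => A [PA Amin] /=; right.
Qed.

Lemma cle_trans (y x z : cardinal) :
  (x <= y)%cardinal -> (y <= z)%cardinal -> (x <= z)%cardinal.
Proof. by case: x y z => [T A|] [U B|] [V C|] //=; exact: card_le_trans. Qed.

Lemma cle_total (x y : cardinal) : (x <= y)%cardinal \/ (y <= x)%cardinal.
Proof.
by case: x y => [T A|] [U B|] /=; by [exact: card_le_total|left|right].
Qed.

Lemma cmin_le (x y z : cardinal) :
  (x <= z)%cardinal \/ (y <= z)%cardinal -> (cmin x y <= z)%cardinal.
Proof.
rewrite /cmin; case: ifP => xy [xz|yz] //; first exact: cle_trans yz.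
by apply: cle_trans xz; case: (cle_total x y) => //; rewrite xy.
Qed.

Lemma setX_le_cmax (T U : Type) (A : set T) (B : set U) :
  infinite_set A -> (Card (A `*` B) <= cmax (Card A) (Card B))%cardinal.
Proof.
move=> infA; rewrite /cmax /=; case: ifP => [AB|nAB].
  apply: card_le_trans (card_leX AB (card_lexx B)) _; apply: infinite_setX_le.
  by move=> /(card_le_finite AB).
apply: (@card_le_trans _ _ _ (A `*` A)); last exact: infinite_setX_le.
by apply: card_leX => //; have [] := card_le_total A B; rewrite ?nAB.
Qed.

(** * Domination, slow inverses of growth functions, and polynomial blocks *)

Lemma eventually_natP (P : nat -> Prop) :
  (\forall n \near \oo, P n) <-> exists m, forall n, m <= n -> P n.
Proof. by split=> [[m _ mP]|[m mP]]; exists m. Qed.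

(** Diagonalization against an enumeration; this makes Hessenberg's theorem applicable to
    [frak_d]. *)
Lemma dominating_infinite (D : set (nat -> nat)) :
  (forall x, exists2 y, D y & le_star x y) -> infinite_set D.
Proof.
move=> Ddom /finite_set_countable/(card_le_surjE (fun=> 0))[e eD].
(* At [n] this function exceeds [e 0 n], ..., [e n n]. If [y] is [e i], domination fails at the
   maximum of [m] and [i]. *)
have [y Dy /eventually_natP[m ym]] := Ddom (fun n => \max_(i < n.+1) (e i n).+1).
have [i _ iy] := eD y Dy.
have := ym (maxn m i) (leq_maxl _ _); rewrite leqNgt => /negP; apply.
apply: (@leq_trans (e i (maxn m i)).+1); first by rewrite iy.
have im : i < (maxn m i).+1 by rewrite ltnS leq_maxr.
by rewrite (leq_bigmax (F := fun j : 'I__ => (e j (maxn m i)).+1) (Ordinal im)).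
Qed.

(* The largest k <= n with N k <= n, and 0 if there is none; for N k = k ^ L it
   is the integral L-th root. *)
Definition last_below (N : nat -> nat) (n : nat) : nat :=
  \max_(k < n.+1 | N k <= n) k.

Lemma last_below_max (N : nat -> nat) (k n : nat) :
  k <= n -> N k <= n -> k <= last_below N n.
Proof.
rewrite -ltnS => kn Nk.
exact: (leq_bigmax_cond (F := fun k : 'I_n.+1 => k : nat) (Ordinal kn) Nk).
Qed.

Lemma last_belowP (N : nat -> nat) (n : nat) :
  N 0 <= n -> N (last_below N n) <= n.
Proof.
move=> N0; rewrite /last_below.
have [|k Nk ->//] := @eq_bigmax_cond _ (fun k : 'I_n.+1 => N k <= n) val.
by apply/card_gt0P; exists ord0.
Qed.

Lemma last_below_cvg (N : nat -> nat) (k : nat) :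
  exists m, forall n, m <= n -> k <= last_below N n.
Proof.
exists (maxn k (N k)) => n; rewrite geq_max => /andP[kn Nk].
exact: last_below_max.
Qed.

Lemma leq_expS (n l : nat) : n <= n ^ l.+1.
Proof. by case: n => // n; rewrite -{1}(expn1 n.+1) leq_pexp2l. Qed.

Lemma rootnE (l n i : nat) : n ^ l.+1 <= i -> i < n.+1 ^ l.+1 ->
  last_below (fun k => k ^ l.+1) i = n.
Proof.
move=> ni ins; apply/eqP; rewrite eqn_leq; apply/andP; split; last first.
  by apply: last_below_max => //; exact: leq_trans (leq_expS _ _) ni.
rewrite -ltnS -(ltn_exp2r _ _ (ltn0Sn l)); apply: leq_ltn_trans ins.
by apply: (@last_belowP (fun k => k ^ l.+1)); rewrite exp0n.
Qed.

Lemma rootn_lt (l i : nat) : i < (last_below (fun k => k ^ l.+1) i).+1 ^ l.+1.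
Proof.
rewrite ltnNge; apply/negP => ri.
have := @last_below_max (fun k => k ^ l.+1) _ i (leq_trans (leq_expS _ _) ri) ri.
by rewrite ltnn.
Qed.

(** The block has room because [n.+1 ^ l.+1] is at least [n.+1 * n ^ l], which is
    [n ^ l.+1 + n ^ l]. *)
Lemma block_bound (l n j : nat) : j < n ^ l -> n ^ l.+1 + j < n.+1 ^ l.+1.
Proof.
move=> jn; apply: (@leq_trans (n ^ l.+1 + n ^ l)); first by rewrite ltn_add2l.
rewrite -[X in _ + X]mul1n expnS -mulnDl addn1 expnS leq_mul2l.
by case: l {jn} => [|l]; rewrite ?expn0 // leq_exp2r // leqnSn orbT.
Qed.

(** * Numerical codes of bit strings, thresholds and enumerations of slaloms *)

Definition bitstrings (m : nat) : seq (seq bool) :=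
  [seq val t | t <- enum {: m.-tuple bool}].

Definition decode (m v : nat) : seq bool := nth (nseq m false) (bitstrings m) v.

Lemma size_decode (m v : nat) : size (decode m v) = m.
Proof.
rewrite /decode; have [vm|mv] := ltnP v (size (bitstrings m)).
  by have /mapP[t _ ->] := mem_nth (nseq m false) vm; rewrite size_tuple.
by rewrite nth_default // size_nseq.
Qed.

Lemma mem_bitstrings (s : seq bool) : s \in bitstrings (size s).
Proof. by apply/mapP; exists (in_tuple s) => //; rewrite mem_enum. Qed.

Lemma decode_index (m : nat) (s : seq bool) :
  size s = m -> decode m (index s (bitstrings m)) = s.
Proof. by move=> <-; rewrite /decode nth_index // mem_bitstrings. Qed.

Lemma index_bitstrings (m : nat) (s : seq bool) :
  size s = m -> index s (bitstrings m) < 2 ^ m.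
Proof.
move=> <-; have := mem_bitstrings s.
by rewrite -index_mem size_map -cardE card_tuple card_bool.
Qed.

Lemma ll_thresholds (u v : nat -> ord_omega) : ll u v ->
  exists M : nat -> nat, forall k n, M k <= n -> ole (u (n ^ k)) (v n).
Proof.
move=> uv.
have /choice[M MP] k : exists m, forall n, m <= n -> ole (u (n ^ k)) (v n).
  by apply/eventually_natP; exact: uv.
by exists M.
Qed.

(** Choosing all enumerations at once makes the covering sequence a function of the slalom. *)
Lemma slalom_enum :
  exists e : set nat -> nat -> nat -> nat,
    forall A m, A #<= `I_m -> A `<=` e A m @` `I_m.
Proof.
have /choice[e eP] (p : set nat * nat) :
    exists e : nat -> nat, p.1 #<= `I_p.2 -> p.1 `<=` e @` `I_p.2.
  have [le|nle] := pselect (p.1 #<= `I_p.2); last by exists id => /nle.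
  by have [e eP] := card_le_surjE 0 le; exists e.
by exists (fun A m => e (A, m)) => A m; exact: (eP (A, m)).
Qed.

(** * Truncating and coding the members of the ideal, and decoding slaloms *)

Section yorioka_slalom.
Variables (f : nat -> nat) (f_mono : forall m n, m <= n -> f m <= f n).

Lemma yoriokaP (X : set (nat -> bool)) : yorioka f X ->
  exists p : (nat -> seq bool) * (nat -> nat), X `<=` limsup_cyl p.1 /\
    forall k n, p.2 k <= n -> f (n ^ k) <= size (p.1 n).
Proof.
move=> [g /ll_thresholds[K KP] [sigma [Xs sg]]].
by exists (sigma, K); split=> // k n /KP; rewrite /= sg.
Qed.

Lemma yorioka_sub (X Y : set (nat -> bool)) :
  X `<=` Y -> yorioka f Y -> yorioka f X.
Proof.
move=> XY [g fg [sigma [Ys sg]]]; exists g => //; exists sigma; split=> //.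
exact: subset_trans Ys.
Qed.

Definition slow_length (N : nat -> nat) (n : nat) : nat :=
  f (n ^ last_below N n).

(* The block [n ^ l.+1, n.+1 ^ l.+1), which has at least n ^ l indices, lists the
   strings coded by e n 0, e n 1, ... *)
Definition block_seq (N : nat -> nat) (l : nat) (e : nat -> nat -> nat)
    (i : nat) : seq bool :=
  let n := last_below (fun k => k ^ l.+1) i in
  decode (slow_length N n) (e n (i - n ^ l.+1)).

(** If [i] lies in block [r], then [i] is below [r.+1 ^ l.+1], hence below [r ^ (2 * l.+1)] once [r]
    is at least 2. So [i ^ k] is at most [r ^ last_below N r] as soon as [last_below N r] reaches
    [2 * l.+1 * k]. *)
Lemma yorioka_block_seq (N : nat -> nat) (l : nat) (e : nat -> nat -> nat) :
  yorioka f (limsup_cyl (block_seq N l e)).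
Proof.
exists (fun i => slow_length N (last_below (fun k => k ^ l.+1) i)); last first.
  by exists (block_seq N l e); split=> // i; rewrite size_decode.
move=> k; apply/eventually_natP.
have [m mP] := last_below_cvg N (2 * l.+1 * k).
have [m' m'P] := last_below_cvg (fun k => k ^ l.+1) (maxn 2 m).
exists m' => i /m'P; have := rootn_lt l i; set r := last_below _ i.
move=> ir; rewrite geq_max => /andP[r2 /mP rk] /=; apply: f_mono.
apply: (@leq_trans (r ^ (2 * l.+1 * k))); last by rewrite leq_pexp2l // ltnW.
rewrite 2!expnM; have [->|k0] := posnP k; first by rewrite !expn0.
rewrite leq_exp2r //; apply: (leq_trans (ltnW ir)); rewrite leq_exp2r //.
apply: (@leq_trans (2 * r)); last by rewrite leq_mul2r r2 orbT.
by rewrite mul2n -addnn -addn1 leq_add2l ltnW.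
Qed.

(** The default 0 keeps the code in [prod_of b] at those [n] where [b n] is too small for the true
    code. *)
Definition truncation_code (b : nat -> ord_omega) (N : nat -> nat)
    (sigma : nat -> seq bool) (n : nat) : nat :=
  let m := slow_length N n in
  let c := index (take m (sigma n)) (bitstrings m) in
  if pselect (elems (b n) c) is left _ then c else 0.

Lemma prod_of_truncation_code (b : nat -> ord_omega) (N : nat -> nat)
    (sigma : nat -> seq bool) : (forall n, b n <> Fin 0) ->
  prod_of b (truncation_code b N sigma).
Proof.
move=> b_neq0 n; rewrite /truncation_code; case: pselect => // _.
by have := b_neq0 n; case: (b n) => [[|m]|].
Qed.

Lemma limsup_cyl_block_seq (b : nat -> ord_omega) (h M K N : nat -> nat)
    (l : nat) (e : nat -> nat -> nat) (sigma : nat -> seq bool)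
    (phi : nat -> set nat) :
  (forall k n, M k <= n -> ole (Fin (2 ^ f (n ^ k))) (b n)) ->
  (forall k n, K k <= n -> f (n ^ k) <= size (sigma n)) ->
  (forall k, M k <= N k) -> le_star K N ->
  le_star h (fun n => n ^ l) -> (forall n, phi n `<=` e n @` `I_(h n)) ->
  localized (truncation_code b N sigma) phi ->
  limsup_cyl sigma `<=` limsup_cyl (block_seq N l e).
Proof.
move=> MP KP MN /eventually_natP[k0 KN] /eventually_natP[m1 hl] eP.
move=> /eventually_natP[m2 loc] x sx m.
have [m3 m3P] := last_below_cvg N k0.
(* Past these bounds, [n] is at least [m], [last_below] obeys [N], [h n] is at most [n ^ l], the
   code is in the slalom, and [K] is below [N] at [last_below N n]. *)
have [n nm sn] := sx (maxn (maxn m (N 0)) (maxn m1 (maxn m2 m3))).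
move: nm; rewrite !geq_max => /and3P[/andP[mn N0n] m1n /andP[m2n m3n]].
have Nn : N (last_below N n) <= n by exact: last_belowP.
set g := slow_length N n; set s := take g (sigma n).
have gs : g <= size (sigma n).
  by apply: KP; apply: leq_trans Nn; apply: KN; exact: m3P.
have size_s : size s = g by rewrite size_takel.
(* There are [2 ^ g] strings of length [g], and [N] dominates the thresholds [M], so the true code
   fits below [b n]. *)
have gb : elems (b n) (index s (bitstrings g)).
  have := MP _ _ (leq_trans (MN _) Nn); rewrite -/(slow_length N n) -/g.
  case: (b n) => //= B; apply: leq_trans; exact: index_bitstrings.
have := loc n m2n; rewrite /truncation_code -/g -/s.
case: pselect => [_|//] /eP[j /= jh ejE].
have jn : j < n ^ l by apply: leq_trans jh _; exact: hl.
(* The truncated string is entry [j] of block [n]. *)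
exists (n ^ l.+1 + j).
  by rewrite (leq_trans mn) // (leq_trans (leq_expS n l)) // leq_addr.
rewrite /block_seq (rootnE (leq_addr _ _) (block_bound jn)) addKn ejE.
rewrite -/g decode_index // => i; rewrite size_s => ig.
by rewrite nth_take // sn // (leq_trans ig).
Qed.

End yorioka_slalom.

(* In Tukey terms: I_f is below the sequential composition of the domination
   order with the localization relation. *)
Lemma yorioka_tukey (f : nat -> nat) (b : nat -> ord_omega) (h : nat -> nat) :
  (forall m n, m < n -> f m < f n) -> (forall n, b n <> Fin 0) ->
  ll (Fin \o pow2 f) b -> (exists l, le_star h (fun n => n ^ l)) ->
  exists (K : set (nat -> bool) -> nat -> nat)
    (x : (nat -> nat) -> set (nat -> bool) -> nat -> nat)
    (Y : (nat -> nat) -> (nat -> set nat) -> set (nat -> bool)),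
  [/\ forall N phi, yorioka f (Y N phi), forall N X, prod_of b (x N X) &
    forall X N phi, yorioka f X -> le_star (K X) N -> slaloms b h phi ->
      localized (x N X) phi -> X `<=` Y N phi].
Proof.
move=> f_incr b_neq0 /ll_thresholds[M MP] [l hl].
have f_mono m n : m <= n -> f m <= f n.
  by rewrite leq_eqVlt => /predU1P[->//|/f_incr/ltnW].
have /choice[p pP] X : exists p : (nat -> seq bool) * (nat -> nat),
    yorioka f X -> X `<=` limsup_cyl p.1 /\
    forall k n, p.2 k <= n -> f (n ^ k) <= size (p.1 n).
  have [/yoriokaP[q qP]|nX] := pselect (yorioka f X); first by exists q.
  by exists (fun=> [::], id) => /nX.
have [e eP] := slalom_enum.
(* The fixed thresholds [M] are absorbed here, so a dominating function has to care only about those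
   of [X]. *)
pose N' N k := maxn (N k) (M k).
exists (fun X => (p X).2), (fun N X => truncation_code f b (N' N) (p X).1).
exists (fun N phi => limsup_cyl (block_seq f (N' N) l (fun n => e (phi n) (h n)))).
split=> [N phi|N X|X N phi IX KN phiS loc].
- exact: yorioka_block_seq.
- exact: prod_of_truncation_code.
have [Xs KP] := pP X IX; apply: subset_trans Xs _.
apply: (limsup_cyl_block_seq MP KP _ _ hl _ loc).
- by move=> k; exact: leq_maxr.
- by apply: filterS KN => k /leq_trans; apply; exact: leq_maxl.
- by move=> n; apply: eP; exact: (phiS n).2.
Qed.

Theorem theorem3p11 (f : nat -> nat) (b : nat -> ord_omega) (h : nat -> nat)
  (f_incr : forall m n, m < n -> f m < f n)
  (b_neq0 : forall n, b n <> Fin 0)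
  (f_ll_b : ll (Fin \o pow2 f) b)
  (h_poly : exists l : nat, le_star h (fun n => n ^ l)) :
  (cmin frak_b (b_Lc b h) <= add (yorioka f))%cardinal /\
  (cof (yorioka f) <= cmax frak_d (d_Lc b h))%cardinal.
Proof.
have [K [x [Y [YI xb XY]]]] := yorioka_tukey f_incr b_neq0 f_ll_b h_poly.
split.
- rewrite /add; case: least_sizeP => [|A [AI nIA]]; first by case: cmin.
  (* Either the threshold functions of the members of [A] are unbounded, and their image bounds
     [frak_b], or one [N] dominates them all and the codes taken along [N] bound [b_Lc]. *)
  apply: cmin_le; have [[N NP]|nN] := pselect
      (exists N, forall z, (K @` A) z -> le_star z N); last first.
    left; apply: (@cle_trans (Card (K @` A))); last exact: card_image_le.
    exact: least_size_le.
  right; apply: (@cle_trans (Card (x N @` A))); last exact: card_image_le.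
  apply: least_size_le; split=> [_ [X AX <-] //|[phi phiS phiP]].
  (* One slalom localizing all the codes would put the whole union inside the single member
     [Y N phi] of the ideal. *)
  apply: nIA; apply: (@yorioka_sub f _ (Y N phi)) => // z [X AX Xz].
  apply: (XY X N phi) Xz => //; first exact: AI.
    by apply: NP; exists X.
  by apply: phiP; exists X.
- rewrite /frak_d /d_Lc.
  case: least_sizeP => [|D DP].
    by rewrite /cmax; case: least_size => [V B|] /=; case: cof.
  case: least_sizeP => [|E [ES EP]]; first by rewrite /cmax /=; case: cof.
  (* The sets [Y N phi] with [N] in [D] and [phi] in [E] are cofinal, and the infinite set [D] lets
     the maximum absorb the product. *)
  apply: cle_trans (setX_le_cmax E (dominating_infinite DP)).
  apply: (@cle_trans (Card ((fun p => Y p.1 p.2) @` (D `*` E)))); last first.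
    exact: card_image_le.
  apply: least_size_le; split=> [_ [p _ <-]|X IX]; first exact: YI.
  have [N DN KN] := DP (K X); have [phi Ephi loc] := EP _ (xb N X).
  exists (Y N phi); first by exists (N, phi).
  by apply: XY => //; exact: ES.
Qed.
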